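(* For $x=(x_1,x_2,x_3)\in\mathbb{C}^3$ the following are equivalent: (1) $x\in\mathbb{E}$; (2) $\|\Psi(\cdot,x)\|_{H^\infty}<1$ and, if $x_1x_2=x_3$, then in addition $|x_2|<1$; (2$'$) $\|\Upsilon(\cdot,x)\|_{H^\infty}<1$ and, if $x_1x_2=x_3$, then in addition $|x_1|<1$; (3) $|x_1-\bar x_2x_3|+|x_1x_2-x_3|<1-|x_2|^2$; (3$'$) $|x_2-\bar x_1x_3|+|x_1x_2-x_3|<1-|x_1|^2$; (4) $|x_1|^2-|x_2|^2+|x_3|^2+2|x_2-\bar x_1x_3|<1$ and $|x_2|<1$; (4$'$) $-|x_1|^2+|x_2|^2+|x_3|^2+2|x_1-\bar x_2x_3|<1$ and $|x_1|<1$; (5) $|x_1|^2+|x_2|^2-|x_3|^2+2|x_1x_2-x_3|<1$ and $|x_3|<1$; (6) $|x_1-\bar x_2x_3|+|x_2-\bar x_1x_3|<1-|x_3|^2$; (7) there exists a $2\times2$ complex matrix $A=[a_{ij}]$ such that $\|A\|<1$ and $x=(a_{11},a_{22},\det A)$; (8) there exists a symmetric $2\times2$ complex matrix $A=[a_{ij}]$ such that $\|A\|<1$ and $x=(a_{11},a_{22},\det A)$; (9) $|x_3|<1$ and there exist $\beta_1,\beta_2\in\mathbb{C}$ such that $|\beta_1|+|\beta_2|<1$ and $x_1=\beta_1+\bar\beta_2x_3$, $x_2=\beta_2+\bar\beta_1x_3$.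
   Context: The tetrablock is $\mathbb{E}=\{x\in\mathbb{C}^3: 1-x_1z-x_2w+x_3zw\ne0 \text{ whenever } |z|\le1,\ |w|\le1\}$. For $z\in\mathbb{C}$, $x\in\mathbb{C}^3$, $$\Psi(z,x)=\frac{x_3z-x_1}{x_2z-1},\qquad \Upsilon(z,x)=\Psi(z,x_2,x_1,x_3)=\frac{x_3z-x_2}{x_1z-1},$$ where, if $x_1x_2=x_3$, $\Psi(\cdot,x)$ is interpreted as the constant function $x_1$ and $\Upsilon(\cdot,x)$ as the constant function $x_2$. $\|\Psi(\cdot,x)\|_{H^\infty}=\sup_{z\in\mathbb{D}}|\Psi(z,x)|$ with $\mathbb{D}$ the open unit disc; this is $+\infty$ if $x_1x_2\neq x_3$ and $|x_2|\ge1$ (similarly for $\Upsilon$ with $|x_1|\geq 1$). $\|A\|$ is the operator norm (largest singular value); symmetric means $A^T=A$. *)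

(* Defs.v *)
From HB Require Import structures.
From mathcomp Require Import all_boot all_order all_algebra.
From mathcomp Require Import complex.
From mathcomp Require Import all_classical all_reals.
From mathcomp Require Import ereal.

Set Implicit Arguments.
Unset Strict Implicit.
Unset Printing Implicit Defensive.

Import Order.TTheory GRing.Theory Num.Theory.
Import Normc.

Local Open Scope classical_set_scope.
Local Open Scope ring_scope.

(* The field of complex numbers is R[i] for R : realType.  Moduli are taken
   with [normc : R[i] -> R], so that inequalities and suprema live in R (or in
   \bar R) instead of in the partially ordered field R[i]. *)

Definition tetrablock (R : realType) : set (R[i] * R[i] * R[i]) :=
  [set x | let: (x1, x2, x3) := x in
    forall z w : R[i], normc z <= 1 -> normc w <= 1 ->
      1 - x1 * z - x2 * w + x3 * z * w != 0].

(* When x1 * x2 != x3 and z = x2^-1, Psi has a pole and the quotient below takes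
   the default value 0.  This does not affect the supremum in [Hinf_norm]: if
   the pole lies in the open unit disc, Psi is unbounded around it there. *)
Definition Psi (R : realType) (z : R[i]) (x : R[i] * R[i] * R[i]) : R[i] :=
  let: (x1, x2, x3) := x in
  if x1 * x2 == x3 then x1 else (x3 * z - x1) / (x2 * z - 1).

Definition Upsilon (R : realType) (z : R[i]) (x : R[i] * R[i] * R[i]) : R[i] :=
  let: (x1, x2, x3) := x in Psi z (x2, x1, x3).

Definition Hinf_norm (R : realType) (f : R[i] -> R[i]) : \bar R :=
  ereal_sup [set (normc (f z))%:E | z in [set z : R[i] | normc z < 1]].

Definition l2norm (R : realType) (n : nat) (v : 'cV[R[i]]_n) : R :=
  Num.sqrt (\sum_i normc (v i 0) ^+ 2).

Definition opnorm (R : realType) (m n : nat) (A : 'M[R[i]]_(m, n)) : R :=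
  sup [set l2norm (A *m v) | v in [set v : 'cV[R[i]]_n | l2norm v <= 1]].

(* Main.v *)
(* Put d = |x1 x2 - x3|, a = |x1 - x2^* x3|, e = |x2 - x1^* x3| and
     P = 1 + |x3|^2 - |x1|^2 - |x2|^2,  Q = 1 + |x1|^2 - |x2|^2 - |x3|^2,
     S = 1 + |x2|^2 - |x1|^2 - |x3|^2.
   Everything is compared with the conjunction of 2d < P, 2a < Q, 2e < S.
   Since P^2 - 4d^2 = Q^2 - 4a^2 = S^2 - 4e^2, and each of P + Q, P + S, Q + S
   is twice some 1 - |xi|^2, the conditions (3)-(6) all reduce to it by real
   algebra that is symmetric in the three pairs (|x1|, a), (|x2|, e), (|x3|, d).
   For (1) and (2): eliminating z, x lies in the tetrablock iff
   |x1 - x3 w| < |1 - x2 w| on the closed disc, and the minimum over |w| = r of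
   the difference of the squares is a quadratic in r, whose minimum on [0, 1] is
   S - 2e, at r = 1, as soon as the inequalities hold.  For (7): if 1 - A diag(z, w)
   is singular, it has a kernel vector that contradicts ||A|| < 1.
   For (8): take the off-diagonal entries to be a square root of x1 x2 - x3, so
   that the Frobenius norm turns 2d < P into ||A||_F^2 < 1 + |det A|^2.
   For (9): x1 - x2^* x3 = (1 - |x3|^2) b1, hence (9) is (6). *)
Require Import Defs.
From HB Require Import structures.
From mathcomp Require Import all_boot all_order all_algebra.
From mathcomp Require Import complex.
From mathcomp Require Import all_classical all_reals.
From mathcomp Require Import ereal.
From mathcomp Require Import ring lra.

Set Implicit Arguments.
Unset Strict Implicit.
Unset Printing Implicit Defensive.

Import Order.TTheory GRing.Theory Num.Theory.
Import Normc.

Local Open Scope ring_scope.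

(** * Inequalities between real numbers standing for the moduli *)

Section RealInequalities.
Variable R : realFieldType.
Implicit Types r s t p q a b c d e : R.

Lemma ltr_sqr_abs p q : 0 <= p -> q ^+ 2 < p ^+ 2 -> q < p /\ - p < q.
Proof. by move=> p0 h; split; rewrite ltNge; apply/negP => k; nra. Qed.

(** The two bounds on [d] turn the last hypothesis into [(r - s)^2 < (1 - t)^2] and
    [(r + s)^2 < (1 + t)^2]. *)
Lemma triangle_lt r s t d : 0 <= r -> 0 <= s -> 0 <= t -> t < 1 ->
  r * s - t <= d -> t - r * s <= d -> d * 2 < 1 + t ^+ 2 - r ^+ 2 - s ^+ 2 ->
  [/\ r < 1, s < 1, r + s < 1 + t, r + t < 1 + s & s + t < 1 + r].
Proof.
move=> r0 s0 t0 t1 d1 d2 P.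
have [||h1 h2] := @ltr_sqr_abs (1 - t) (r - s); [lra|nra|].
have [||h3 _] := @ltr_sqr_abs (1 + t) (r + s); [lra|nra|].
by split; lra.
Qed.

Lemma gap_pos r s t : 0 <= r -> 0 <= s -> 0 <= t -> r < 1 -> s < 1 -> t < 1 ->
  r + s < 1 + t -> 0 < 1 + t ^+ 2 - r ^+ 2 - s ^+ 2.
Proof.
move=> r0 s0 t0 r1 s1 t1 h.
(* If [r + s >= 1], putting [r + s - 1] for [t] gives the lower bound [2 (1 - r) (1 - s)]. *)
have [k|k] := lerP 1 (r + s).
  have k1: (r + s - 1) ^+ 2 < t ^+ 2 by nra.
  have := mulr_gt0 (_ : 0 < 1 - r) (_ : 0 < 1 - s); rewrite !subr_gt0 => /(_ r1 s1).
  nra.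
nra.
Qed.

(** The equation amounts to [Q^2 - 4 a^2 = P^2 - 4 d^2]; to take roots, [gap_pos] supplies
    [0 < Q]. *)
Lemma gap_transfer r s t a d : 0 <= r -> 0 <= s -> 0 <= t -> 0 <= d -> t < 1 ->
  r * s - t <= d -> t - r * s <= d ->
  a ^+ 2 - d ^+ 2 = (r ^+ 2 - t ^+ 2) * (1 - s ^+ 2) ->
  d * 2 < 1 + t ^+ 2 - r ^+ 2 - s ^+ 2 -> a * 2 < 1 + r ^+ 2 - s ^+ 2 - t ^+ 2.
Proof.
move=> r0 s0 t0 d0 t1 d1 d2 E P.
have [r1 s1 h1 h2 h3] := triangle_lt r0 s0 t0 t1 d1 d2 P.
have Q := gap_pos s0 t0 r0 s1 t1 r1 h3.
have [||//] := @ltr_sqr_abs (1 + r ^+ 2 - s ^+ 2 - t ^+ 2) (a * 2); [lra|].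
have : (d * 2) ^+ 2 < (1 + t ^+ 2 - r ^+ 2 - s ^+ 2) ^+ 2 by nra.
by rewrite exprMn; nra.
Qed.

Lemma gap_sum r s t a d : 0 <= r -> 0 <= s -> 0 <= t -> 0 <= a -> 0 <= d ->
  r * s - t <= d -> t - r * s <= d -> r - s * t <= a -> s * t - r <= a ->
  a ^+ 2 - d ^+ 2 = (r ^+ 2 - t ^+ 2) * (1 - s ^+ 2) ->
  a + d < 1 - s ^+ 2 -> d * 2 < 1 + t ^+ 2 - r ^+ 2 - s ^+ 2 /\ t < 1.
Proof.
move=> r0 s0 t0 a0 d0 d1 d2 a1 a2 E h.
have D0 : 0 < 1 - s ^+ 2 by lra.
have s1 : s < 1 by nra.
(* With [D = 1 - s^2], the equation gives [D (P - 2 d) = (D - d)^2 - a^2] and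
   [D (Q - 2 a) = (D - a)^2 - d^2], both positive as [a + d < D]. *)
have P : d * 2 < 1 + t ^+ 2 - r ^+ 2 - s ^+ 2.
  by rewrite -subr_gt0 -(pmulr_rgt0 _ D0); nra.
have Q : a * 2 < 1 + r ^+ 2 - s ^+ 2 - t ^+ 2.
  by rewrite -subr_gt0 -(pmulr_rgt0 _ D0); nra.
(* If [t >= 1], the two gaps give [|r - s| < t - 1] and [|t - s| < |r - 1|], which is impossible for
   [s < 1]. *)
split=> //; rewrite ltNge; apply/negP => t1.
have [||h1 h2] := @ltr_sqr_abs (t - 1) (r - s); [lra|nra|].
have [r1|r1] := lerP 1 r.
  have [||h3 h4] := @ltr_sqr_abs (r - 1) (t - s); [lra|nra|lra].
have [||h3 h4] := @ltr_sqr_abs (1 - r) (t - s); [lra|nra|lra].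
Qed.

(** The two sides differ by [(1 - x) (2 e - b (1 + x))] with [b = s^2 - t^2], so it suffices that
    [b <= e]. *)
Lemma radial_min r s t e x : 0 <= r -> 0 <= s -> 0 <= t -> 0 <= e ->
  s < 1 -> s - r * t <= e -> r * t - s <= e ->
  e * 2 < 1 + s ^+ 2 - r ^+ 2 - t ^+ 2 -> 0 <= x <= 1 ->
  1 + s ^+ 2 - r ^+ 2 - t ^+ 2 - e * 2 <=
  1 - r ^+ 2 + (s ^+ 2 - t ^+ 2) * x ^+ 2 - e * x * 2.
Proof.
move=> r0 s0 t0 e0 s1 e1 e2 S /andP[x0 x1].
have [r1 _ h1 h2 h3] := triangle_lt r0 t0 s0 s1 e2 e1 S.
have B : s ^+ 2 - t ^+ 2 <= e.
  rewrite leNgt; apply/negP => k.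
  have k1 : s * (1 - s) < t * (1 - s) by nra.
  have k2 : s < t by rewrite ltr_pM2r // in k1; lra.
  nra.
have : 0 <= (1 - x) * (e * 2 - (s ^+ 2 - t ^+ 2) * (1 + x)).
  apply: mulr_ge0; first lra.
  nra.
by move=> ?; lra.
Qed.

(** Positivity of the symmetric matrix with diagonal [k - a], [k - b] and off-diagonal entry
    [- c]. *)
Lemma quad_form_le k a b c p q : 0 <= p -> 0 <= q -> a <= k -> b <= k -> 0 <= c ->
  c ^+ 2 <= (k - a) * (k - b) ->
  a * p ^+ 2 + b * q ^+ 2 + c * p * q * 2 <= k * (p ^+ 2 + q ^+ 2).
Proof.
move=> p0 q0 ak bk c0 h.
suff : c * p * q * 2 <= (k - a) * p ^+ 2 + (k - b) * q ^+ 2 by nra.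
have X0 : 0 <= (k - a) * p ^+ 2 + (k - b) * q ^+ 2.
  by rewrite addr_ge0 // mulr_ge0 ?sqr_ge0 ?subr_ge0.
rewrite -ler_sqr ?nnegrE ?mulr_ge0 //.
have : c ^+ 2 * (p * q) ^+ 2 <= (k - a) * (k - b) * (p * q) ^+ 2.
  by rewrite ler_wpM2r ?sqr_ge0.
have := sqr_ge0 ((k - a) * p ^+ 2 - (k - b) * q ^+ 2).
by nra.
Qed.

(* In the application [r], [s], [t] are the moduli of [x1], [x2], [x3], while
   [a], [e], [d] are those of [x1 - x2^* x3], [x2 - x1^* x3], [x1 x2 - x3].
   The relation is invariant under permuting the pairs (r, a), (s, e), (t, d). *)
Record coupled r s t a e d : Prop := Coupled {
  coupled_r : 0 <= r;
  coupled_s : 0 <= s;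
  coupled_t : 0 <= t;
  coupled_a : `|r - s * t| <= a;
  coupled_e : `|s - r * t| <= e;
  coupled_d : `|t - r * s| <= d;
  coupled_ad : a ^+ 2 - d ^+ 2 = (r ^+ 2 - t ^+ 2) * (1 - s ^+ 2);
  coupled_ed : e ^+ 2 - d ^+ 2 = (s ^+ 2 - t ^+ 2) * (1 - r ^+ 2) }.

Definition gaps r s t a e d : Prop :=
  [/\ a * 2 < 1 + r ^+ 2 - s ^+ 2 - t ^+ 2,
      e * 2 < 1 + s ^+ 2 - r ^+ 2 - t ^+ 2 &
      d * 2 < 1 + t ^+ 2 - r ^+ 2 - s ^+ 2].

Lemma coupled_rs r s t a e d : coupled r s t a e d -> coupled s r t e a d.
Proof. by case=> *; split=> //; rewrite [s * r]mulrC. Qed.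

Lemma coupled_rt r s t a e d : coupled r s t a e d -> coupled t s r d e a.
Proof.
case=> r0 s0 t0 ha he hd E1 E2.
by split; rewrite // 1?[t * s]mulrC 1?[t * r]mulrC 1?[s * r]mulrC //; lra.
Qed.

Lemma coupled_st r s t a e d : coupled r s t a e d -> coupled r t s a d e.
Proof. by move/coupled_rs/coupled_rt/coupled_rs. Qed.

Lemma gaps_rs r s t a e d : gaps r s t a e d -> gaps s r t e a d.
Proof. by case=> Q S P; split; lra. Qed.

Lemma gaps_rt r s t a e d : gaps r s t a e d -> gaps t s r d e a.
Proof. by case=> Q S P; split; lra. Qed.

Lemma gaps_st r s t a e d : gaps r s t a e d -> gaps r t s a d e.
Proof. by move/gaps_rs/gaps_rt/gaps_rs. Qed.

Lemma gaps_lt1 r s t a e d : coupled r s t a e d -> gaps r s t a e d ->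
  [/\ r < 1, s < 1 & t < 1].
Proof.
case=> r0 s0 t0 ha he hd _ _ [Q S P].
have := (le_trans (normr_ge0 _) ha, le_trans (normr_ge0 _) he,
  le_trans (normr_ge0 _) hd) => -[[a0 e0] d0].
have sq1 p : p ^+ 2 < 1 -> p < 1 by move=> h; nra.
by split; apply: sq1; lra.
Qed.

(** One gap yields the other two by [gap_transfer]. Permuting the pairs gives (4), (4') and (5). *)
Lemma gapsP r s t a e d : coupled r s t a e d ->
  gaps r s t a e d <-> d * 2 < 1 + t ^+ 2 - r ^+ 2 - s ^+ 2 /\ t < 1.
Proof.
move=> C; split=> [G|[P t1]]; first by have [_ _ ?] := gaps_lt1 C G; case: G.
case: C => r0 s0 t0 _ _ hd E1 E2.
have d0 := le_trans (normr_ge0 _) hd.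
move: hd; rewrite ler_norml => /andP[d1 d2].
split=> //.
  by apply: (@gap_transfer r s t a d) => //; lra.
by apply: (@gap_transfer s r t e d) => //; lra.
Qed.

(** Permuting the pairs gives (3), (3') and (6). *)
Lemma gaps_sumP r s t a e d : coupled r s t a e d ->
  gaps r s t a e d <-> a + d < 1 - s ^+ 2.
Proof.
move=> C; split=> [[Q S P]|h]; first lra.
apply/(gapsP C); case: C => r0 s0 t0 ha _ hd E1 _.
have a0 := le_trans (normr_ge0 _) ha; have d0 := le_trans (normr_ge0 _) hd.
move: ha hd; rewrite !ler_norml => /andP[a1 a2] /andP[d1 d2].
by apply: (@gap_sum r s t a d) => //; lra.
Qed.

End RealInequalities.

(** * Moduli of complex numbers and two polynomial identities *)

Section Modulus.
Variable R : realType.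
Implicit Types x y z w c : R[i].

Lemma normc_ge0 x : 0 <= normc x.
Proof. by case: x => a b; apply: sqrtr_ge0. Qed.

Lemma sqr_normcE x : normc x ^+ 2 = complex.Re x ^+ 2 + complex.Im x ^+ 2.
Proof. by case: x => a b; rewrite sqr_sqrtr // addr_ge0 ?sqr_ge0. Qed.

Lemma ler_normcD x y : normc (x + y) <= normc x + normc y.
Proof. exact: le_normcD. Qed.

Lemma normc_opp x : normc (- x) = normc x.
Proof. exact: normcN. Qed.

Lemma normc_conj x : normc x^*%C = normc x.
Proof. by case: x => a b /=; rewrite sqrrN. Qed.

Lemma normc_real (t : R) : 0 <= t -> normc t%:C%C = t.
Proof. by move=> t0; rewrite /= expr0n addr0 sqrtr_sqr ger0_norm. Qed.

Lemma normc_distC x y : normc (x - y) = normc (y - x).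
Proof. by rewrite -normc_opp opprB. Qed.

Lemma lerB_normcB x y : normc x - normc y <= normc (x - y).
Proof. by rewrite lerBlDr -{1}(subrK y x) ler_normcD. Qed.

Lemma ler_Re_normc x : complex.Re x <= normc x.
Proof.
case: x => a b /=; apply: (le_trans (ler_norm a)).
by rewrite -sqrtr_sqr ler_wsqrtr // lerDl sqr_ge0.
Qed.

Lemma normc_eq0 x : (normc x == 0) = (x == 0).
Proof. by apply/eqP/eqP => [/eq0_normc//|->]; rewrite normc0. Qed.

Lemma exists_phase c : exists2 w, normc w = 1 & c * w = (normc c)%:C%C.
Proof.
have [->|c0] := eqVneq c 0; first by exists 1; rewrite ?normc1 // mul0r normc0.
have n0 : normc c != 0 by rewrite normc_eq0.
exists (((normc c)^-1)%:C%C * c^*%C).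
  by rewrite normcM normc_conj normc_real ?invr_ge0 ?normc_ge0 // mulVf.
have -> : c * (((normc c)^-1)%:C * c^*)%C = ((normc c)^-1 * normc c ^+ 2)%:C%C.
  by rewrite sqr_normcE; case: c {c0 n0} => a b; apply/eqP; rewrite eq_complex /=;
     apply/andP; split; apply/eqP; ring.
by congr (_%:C%C); field.
Qed.

Lemma sqr_normc_gap x1 x2 x3 :
  normc (x1 - x2^*%C * x3) ^+ 2 - normc (x1 * x2 - x3) ^+ 2 =
  (normc x1 ^+ 2 - normc x3 ^+ 2) * (1 - normc x2 ^+ 2).
Proof. by rewrite !sqr_normcE; case: x1 x2 x3 => [a b] [c d] [e f] /=; ring. Qed.

Lemma sqr_normc_pencil x1 x2 x3 w :
  normc (1 - x2 * w) ^+ 2 - normc (x1 - x3 * w) ^+ 2 =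
  1 - normc x1 ^+ 2 + (normc x2 ^+ 2 - normc x3 ^+ 2) * normc w ^+ 2
  - complex.Re ((x2 - x1^*%C * x3) * w) * 2.
Proof.
rewrite !sqr_normcE; case: x1 x2 x3 w => [a b] [c d] [e f] [g h] /=; ring.
Qed.

End Modulus.

(** * The gaps of a complex triple *)

Section ModulusGaps.
Variable R : realType.
Implicit Types x y z w c : R[i].

Definition tetra_gaps x1 x2 x3 : Prop :=
  gaps (normc x1) (normc x2) (normc x3) (normc (x1 - x2^*%C * x3))
    (normc (x2 - x1^*%C * x3)) (normc (x1 * x2 - x3)).

Lemma coupled_normc x1 x2 x3 :
  coupled (normc x1) (normc x2) (normc x3) (normc (x1 - x2^*%C * x3))
    (normc (x2 - x1^*%C * x3)) (normc (x1 * x2 - x3)).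
Proof.
have dist x y : `|normc x - normc y| <= normc (x - y).
  by rewrite ler_norml lerB_normcB lerNl opprB normc_distC lerB_normcB.
split; rewrite ?normc_ge0 ?sqr_normc_gap //.
- by rewrite -(normc_conj x2) -normcM dist.
- by rewrite -(normc_conj x1) -normcM dist.
- by rewrite -normcM distrC dist.
- by rewrite [x1 * x2]mulrC sqr_normc_gap.
Qed.

Lemma tetra_gapsC x1 x2 x3 : tetra_gaps x2 x1 x3 <-> tetra_gaps x1 x2 x3.
Proof. by split=> /gaps_rs; rewrite /tetra_gaps [x2 * x1]mulrC. Qed.

End ModulusGaps.

(** Replaces the limit [u -> 0] when a pole or the unit circle is approached. *)
Lemma le0_of_small (R : realFieldType) (h k : R) : 0 <= k ->
  (forall u, 0 < u <= 1 -> h <= u * k) -> h <= 0.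
Proof.
move=> k0 hk; rewrite leNgt; apply/negP => h0.
have D0 : 0 < h + k + 1 by lra.
(* This [u] lies in [(0, 1]] and satisfies [u * k < h]. *)
have := hk (h / (h + k + 1)).
rewrite divr_gt0 // ler_pdivrMr // mul1r.
have -> : h <= h + k + 1 by lra.
move=> /(_ isT); rewrite mulrAC ler_pdivlMr //; nra.
Qed.

(** * The tetrablock and the function [Psi] *)

Section Tetrablock.
Variable R : realType.
Implicit Types x y z w c : R[i].

(** For fixed [w] the polynomial is affine in [z], with root [(1 - x2 w) / (x1 - x3 w)]. *)
Lemma tetrablockP x1 x2 x3 : tetrablock (x1, x2, x3) <->
  forall w, normc w <= 1 -> normc (x1 - x3 * w) < normc (1 - x2 * w).
Proof.
have E z w : 1 - x1 * z - x2 * w + x3 * z * w = (1 - x2 * w) - (x1 - x3 * w) * z.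
  by ring.
split=> [h w w1|h z w z1 w1].
  rewrite ltNge; apply/negP => k.
  (* In the degenerate case both coefficients vanish, so [z = 0] is a root. *)
  have [x0|x0] := eqVneq (x1 - x3 * w) 0.
    have := h 0 w; rewrite normc0 E x0 mul0r subr0 -normc_eq0.
    by rewrite ler01 w1 eq_le normc_ge0 andbT (le_trans k) ?x0 ?normc0 // => /(_ isT isT).
  have := h ((1 - x2 * w) / (x1 - x3 * w)) w.
  rewrite E [(x1 - _) * _]mulrC divfK // subrr eqxx normcM normcV.
  rewrite ler_pdivrMr ?mul1r ?lt_neqAle ?normc_ge0 ?andbT 1?eq_sym ?normc_eq0 //.
  by move/(_ k w1).
rewrite E subr_eq0; apply/eqP => k; have := h w w1.
by rewrite k normcM ltNge ler_piMr ?normc_ge0.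
Qed.

(** On this ray the real part in [sqr_normc_pencil] equals the modulus, so the difference is minimal
    for given [|w|]. *)
Lemma exists_pencil_ray x1 x2 x3 : exists2 w, normc w = 1 & forall t : R, 0 <= t ->
  normc (1 - x2 * (t%:C%C * w)) ^+ 2 - normc (x1 - x3 * (t%:C%C * w)) ^+ 2 =
  1 - normc x1 ^+ 2 + (normc x2 ^+ 2 - normc x3 ^+ 2) * t ^+ 2
  - normc (x2 - x1^*%C * x3) * t * 2.
Proof.
have [w w1 Ew] := exists_phase (x2 - x1^*%C * x3); exists w => // t t0.
rewrite sqr_normc_pencil normcM w1 mulr1 normc_real // [_ * (_ * w)]mulrCA Ew.
by rewrite /= mul0r subr0 [t * _]mulrC.
Qed.

(** The bound is uniform in [w], as a supremum strictly below 1 demands. *)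
Lemma tetra_gaps_pencil x1 x2 x3 : tetra_gaps x1 x2 x3 ->
  exists2 m, 0 < m & forall w, normc w <= 1 ->
    m <= normc (1 - x2 * w) ^+ 2 - normc (x1 - x3 * w) ^+ 2.
Proof.
move=> G; have C := coupled_normc x1 x2 x3.
have [_ s1 _] := gaps_lt1 C G.
case: G => _ S _; exists (1 + normc x2 ^+ 2 - normc x1 ^+ 2 - normc x3 ^+ 2
  - normc (x2 - x1^*%C * x3) * 2) => [|w w1]; first by lra.
rewrite sqr_normc_pencil; case: C => r0 s0 t0 _ he _ _ _.
have e0 := le_trans (normr_ge0 _) he; move: he; rewrite ler_norml => /andP[e1 e2].
have w01 : 0 <= normc w <= 1 by rewrite normc_ge0.
apply: (le_trans (@radial_min _ (normc x1) (normc x2) (normc x3)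
  (normc (x2 - x1^*%C * x3)) (normc w) _ _ _ _ _ _ _ _ _)) => //; first by lra.
by rewrite lerB // ler_wpM2r // -normcM ler_Re_normc.
Qed.

Lemma tetra_gapsP4 x1 x2 x3 : tetra_gaps x1 x2 x3 <->
  normc (x2 - x1^*%C * x3) * 2
    < 1 + normc x2 ^+ 2 - normc x1 ^+ 2 - normc x3 ^+ 2 /\ normc x2 < 1.
Proof.
have := gapsP (coupled_st (coupled_normc x1 x2 x3)).
rewrite addrAC => <-; split => /gaps_st; exact.
Qed.

Lemma tetrablock_gaps x1 x2 x3 : tetrablock (x1, x2, x3) <-> tetra_gaps x1 x2 x3.
Proof.
rewrite tetrablockP; split=> [h|/tetra_gaps_pencil[m m0 h] w w1]; last first.
  rewrite -ltr_sqr ?nnegrE ?normc_ge0 // -subr_gt0.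
  exact: lt_le_trans m0 (h _ w1).
apply/tetra_gapsP4; split.
  have [w w1 E] := exists_pencil_ray x1 x2 x3.
  have := E 1 ler01; rewrite mul1r expr1n !mulr1 => {}E.
  have : normc (x1 - x3 * w) ^+ 2 < normc (1 - x2 * w) ^+ 2.
    by rewrite ltr_sqr ?nnegrE ?normc_ge0 // h // w1.
  lra.
(* If [|x2| >= 1], the point [w = 1 / x2] of the closed disc annihilates [1 - x2 w]. *)
rewrite ltNge; apply/negP => s1.
have := h x2^-1; rewrite normcV invf_le1 ?(lt_le_trans ltr01) // => /(_ s1).
rewrite mulfV ?subrr ?normc0 1?ltNge ?normc_ge0 // -normc_eq0.
by rewrite gt_eqF // (lt_le_trans ltr01).
Qed.

(** The supremum itself serves as [c]; the value of [f] at 0 excludes [-oo]. *)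
Lemma Hinf_norm_lt1P (f : R[i] -> R[i]) : (Hinf_norm f < 1)%E <->
  exists c : R, [/\ 0 <= c, c < 1 & forall z, normc z < 1 -> normc (f z) <= c].
Proof.
split=> [h|[c [c0 c1 h]]]; last first.
  apply: (@le_lt_trans _ _ c%:E); last by rewrite lte_fin.
  by apply: ge_ereal_sup => _ [z /= z1 <-]; rewrite lee_fin h.
have ub z : normc z < 1 -> ((normc (f z))%:E <= Hinf_norm f)%E.
  by move=> z1; apply: ereal_sup_ubound; exists z.
have := ub 0; rewrite normc0 => /(_ ltr01) => h0.
move: h h0 ub; case: (Hinf_norm f) => [c| |] //; rewrite lte_fin lee_fin => c1 c0 ub.
exists c; split=> //; exact: le_trans (normc_ge0 _) c0.
Qed.

Lemma Psi_gaps x1 x2 x3 :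
  (Hinf_norm (fun z => Psi z (x1, x2, x3)) < 1)%E /\ (x1 * x2 = x3 -> normc x2 < 1)
  <-> tetra_gaps x1 x2 x3.
Proof.
rewrite Hinf_norm_lt1P /Psi; split; last first.
  move=> G; have [r1 s1 _] := gaps_lt1 (coupled_normc x1 x2 x3) G.
  split=> //; case: eqP => E; first by exists (normc x1); rewrite normc_ge0.
  have [m m0 h] := tetra_gaps_pencil G.
  (* [|1 - x2 z|^2 <= 4], so the pencil bound gives
     [|x1 - x3 z|^2 <= (1 - m / 4) |1 - x2 z|^2]. *)
  have c1 : Num.sqrt (1 - m / 4) < 1 by rewrite -[ltRHS]sqrtr1 ltr_sqrt //; lra.
  exists (Num.sqrt (1 - m / 4)); split=> [||z z1]; [exact: sqrtr_ge0|exact: c1|].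
  have q0 := normc_ge0 (1 - x2 * z).
  have q2 : normc (1 - x2 * z) <= 2.
    apply: (le_trans (ler_normcD _ _)); rewrite normc_opp normc1 normcM.
    have := normc_ge0 x2; have := normc_ge0 z; nra.
  have hz := h z (ltW z1).
  have m4 : m <= 4 by have := sqr_ge0 (normc (x1 - x3 * z)); nra.
  have qpos : 0 < normc (1 - x2 * z).
    by have := sqr_ge0 (normc (x1 - x3 * z)); nra.
  rewrite normcM normcV normc_distC [normc (x2 * z - 1)]normc_distC.
  rewrite ler_pdivrMr // -ler_sqr ?nnegrE ?mulr_ge0 ?sqrtr_ge0 ?normc_ge0 //.
  rewrite exprMn sqr_sqrtr; last by lra.
  have : m * normc (1 - x2 * z) ^+ 2 <= m * 4 by rewrite ler_wpM2l ?(ltW m0) //; nra.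
  lra.
case: eqP => [E [[c [c0 c1 hc]] /(_ E) s1]|E [[c [c0 c1 hc]] _]].
  have r1 : normc x1 < 1 by apply: le_lt_trans c1; apply: (hc 0); rewrite normc0 ltr01.
  apply/gapsP; first exact: coupled_normc.
  rewrite -E subrr normc0 normcM mul0r exprMn.
  have := normc_ge0 x1; have := normc_ge0 x2 => ? ?; split; last by nra.
  (* For [x3 = x1 x2] the gap [P - 2 d] is exactly this product. *)
  have : 0 < (1 - normc x1 ^+ 2) * (1 - normc x2 ^+ 2) by apply: mulr_gt0; nra.
  lra.
(* If [|x2| >= 1], the points [z = (1 - u) / x2] tend to the pole with [|x2 z - 1| = u], hence
   [|x3 z - x1| <= c u]; as [u -> 0] this forces [x3 = x1 x2]. *)
have s1 : normc x2 < 1.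
  rewrite ltNge; apply/negP => s1.
  have x20 : x2 != 0 by rewrite -normc_eq0 gt_eqF // (lt_le_trans ltr01).
  apply: E; apply/eqP; rewrite eq_sym -subr_eq0.
  have -> : x3 - x1 * x2 = x2 * (x3 / x2 - x1) by field.
  rewrite mulf_eq0 (negPf x20) /= -normc_eq0 eq_le normc_ge0 andbT.
  apply: (@le0_of_small _ _ (c + normc (x3 / x2))); first by rewrite addr_ge0 ?normc_ge0.
  move=> u /andP[u0 u1].
  have u1' : 0 <= 1 - u by lra.
  have nz : normc ((1 - u)%:C%C / x2) < 1.
    rewrite normcM normcV normc_real // ltr_pdivrMr; lra.
  have nden : normc (x2 * ((1 - u)%:C%C / x2) - 1) = u.
    rewrite mulrCA mulfV // mulr1 normc_distC.
    have -> : 1 - (1 - u)%:C%C = u%:C%C by rewrite rmorphB rmorph1; ring.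
    by rewrite normc_real // ltW.
  have := hc _ nz; rewrite normcM normcV nden ler_pdivrMr // => hz.
  have -> : x3 / x2 - x1 = (x3 * ((1 - u)%:C%C / x2) - x1) + u%:C%C * (x3 / x2).
    by rewrite rmorphB rmorph1; ring.
  apply: (le_trans (ler_normcD _ _)); rewrite normcM (normc_real (ltW u0)).
  by rewrite mulrDr lerD2r [u * c]mulrC.
apply/tetra_gapsP4; split=> //.
(* Comes from [|x1 - x3 w| <= c |1 - x2 w|] and [1 - |x2| <= |1 - x2 w|]. Being independent of [w],
   it keeps the inequality strict on the circle. *)
pose m := (1 - c ^+ 2) * (1 - normc x2) ^+ 2.
have m0 : 0 < m by rewrite mulr_gt0 ?exprn_gt0 ?subr_gt0 //; nra.
have lb w : normc w < 1 -> m <= normc (1 - x2 * w) ^+ 2 - normc (x1 - x3 * w) ^+ 2.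
  move=> w1; have := hc _ w1.
  have q1 : 1 - normc x2 <= normc (1 - x2 * w).
    apply: (le_trans _ (lerB_normcB _ _)); rewrite normc1 lerB // normcM.
    by rewrite ler_piMr ?normc_ge0 // ltW.
  have q0 : 0 < normc (1 - x2 * w) by lra.
  rewrite normcM normcV normc_distC [normc (x2 * w - 1)]normc_distC ler_pdivrMr // => h.
  have h2 : normc (x1 - x3 * w) ^+ 2 <= c ^+ 2 * normc (1 - x2 * w) ^+ 2.
    by rewrite -exprMn ler_sqr ?nnegrE ?mulr_ge0 ?normc_ge0 // ltW.
  have : m <= (1 - c ^+ 2) * normc (1 - x2 * w) ^+ 2.
    by rewrite ler_wpM2l ?ler_sqr ?nnegrE //; nra.
  lra.
have [w w1 Ew] := exists_pencil_ray x1 x2 x3.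
set e := normc (x2 - x1^*%C * x3) in Ew *.
set b := normc x2 ^+ 2 - normc x3 ^+ 2 in Ew.
(* Use [lb] on the ray at [t = 1 - u]; the error against [t = 1] is [O(u)]. *)
suff : m - (1 - normc x1 ^+ 2 + b - e * 2) <= 0 by rewrite /b; lra.
apply: (@le0_of_small _ _ (`|e * 2 - b * 2| + `|b|)); first by rewrite addr_ge0.
move=> u /andP[u0 u1]; have u1' : 0 <= 1 - u by lra.
have := lb ((1 - u)%:C%C * w); rewrite normcM w1 normc_real // mulr1 Ew //.
have -> : 1 - u < 1 by lra.
move/(_ isT) => h.
have k1 : u * (e * 2 - b * 2) <= u * `|e * 2 - b * 2|.
  by rewrite ler_wpM2l ?ler_norm // ltW.
have k2 : u ^+ 2 * b <= u * `|b|.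
  apply: (@le_trans _ _ (u ^+ 2 * `|b|)); first by rewrite ler_wpM2l ?ler_norm ?sqr_ge0.
  by rewrite ler_wpM2r //; nra.
nra.
Qed.

End Tetrablock.

(** * Operator norms of 2x2 matrices *)

Section OperatorNorm.
Variable R : realType.
Implicit Types (A : 'M[R[i]]_2) (v : 'cV[R[i]]_2).

Lemma l2norm_ge0 n (v : 'cV[R[i]]_n) : 0 <= l2norm v.
Proof. exact: sqrtr_ge0. Qed.

Lemma sqr_l2norm2 v : l2norm v ^+ 2 = normc (v 0 0) ^+ 2 + normc (v 1 0) ^+ 2.
Proof.
rewrite sqr_sqrtr; last by apply: sumr_ge0 => i _; rewrite sqr_ge0.
by rewrite big_ord_recl big_ord1; congr (_ + normc (v _ 0) ^+ 2); apply: val_inj.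
Qed.

Lemma l2normZ (t : R) v : 0 <= t -> l2norm (t%:C%C *: v) = t * l2norm v.
Proof.
move=> t0; apply: (pexpIrn (n := 2)) => //; rewrite ?nnegrE ?mulr_ge0 ?l2norm_ge0 //.
by rewrite exprMn !sqr_l2norm2 !mxE !normcM normc_real // !exprMn mulrDr.
Qed.

Lemma l2norm_eq0 v : (l2norm v == 0) = (v == 0).
Proof.
rewrite -sqrf_eq0 sqr_l2norm2 paddr_eq0 ?sqr_ge0 // !expf_eq0 /= !normc_eq0.
apply/andP/eqP => [[/eqP v0 /eqP v1]|->]; last by rewrite !mxE.
by apply/matrixP => i j; rewrite ord1 mxE; case: i => [[|[|//]] ?];
   [rewrite -[RHS]v0|rewrite -[RHS]v1]; congr (v _ _); apply: val_inj.
Qed.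

Lemma det_mx2E A : \det A = A 0 0 * A 1 1 - A 0 1 * A 1 0.
Proof.
rewrite (expand_det_row _ 0) !big_ord_recl big_ord0 /cofactor !det_mx11 !mxE /=.
rewrite /bump /= !addn0 expr0 expr1 mul1r addr0 mulN1r mulrN.
by congr (A _ _ * A _ _ - A _ _ * A _ _); apply: val_inj.
Qed.

Lemma mulmx2E A v i : (A *m v) i 0 = A i 0 * v 0 0 + A i 1 * v 1 0.
Proof.
by rewrite mxE big_ord_recl big_ord1; congr (_ + A _ _ * v _ _); apply: val_inj.
Qed.

(** The determinant of the Gram matrix [A^* A] is [|det A|^2]. *)
Lemma sqr_normc_gram A :
  normc ((A 0 0)^*%C * A 0 1 + (A 1 0)^*%C * A 1 1) ^+ 2 =
  (normc (A 0 0) ^+ 2 + normc (A 1 0) ^+ 2) * (normc (A 0 1) ^+ 2 + normc (A 1 1) ^+ 2)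
  - normc (\det A) ^+ 2.
Proof.
rewrite det_mx2E !sqr_normcE.
by case: (A 0 0) (A 0 1) (A 1 0) (A 1 1) => [? ?] [? ?] [? ?] [? ?] /=; ring.
Qed.

(** [a] and [b] are the diagonal of [A^* A], and the hypotheses say that [k - A^* A] is positive
    semidefinite. *)
Lemma sqr_l2norm_mul_le A v (k : R) :
  let a := normc (A 0 0) ^+ 2 + normc (A 1 0) ^+ 2 in
  let b := normc (A 0 1) ^+ 2 + normc (A 1 1) ^+ 2 in
  a <= k -> b <= k -> a * b - normc (\det A) ^+ 2 <= (k - a) * (k - b) ->
  l2norm (A *m v) ^+ 2 <= k * l2norm v ^+ 2.
Proof.
move=> a b ak bk h.
pose g := (A 0 0)^*%C * A 0 1 + (A 1 0)^*%C * A 1 1.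
have E : l2norm (A *m v) ^+ 2 = a * normc (v 0 0) ^+ 2 + b * normc (v 1 0) ^+ 2
    + complex.Re (g * ((v 0 0)^*%C * v 1 0)) * 2.
  rewrite sqr_l2norm2 !mulmx2E /a /b /g !sqr_normcE.
  by case: (A 0 0) (A 0 1) (A 1 0) (A 1 1) (v 0 0) (v 1 0)
    => [? ?] [? ?] [? ?] [? ?] [? ?] [? ?] /=; ring.
rewrite E sqr_l2norm2.
apply: le_trans (quad_form_le (c := normc g) (normc_ge0 _) (normc_ge0 _) ak bk
  (normc_ge0 _) _); last by rewrite sqr_normc_gram.
rewrite lerD2l ler_wpM2r // (le_trans (ler_Re_normc _)) //.
by rewrite !normcM normc_conj mulrA.
Qed.

Lemma opnorm_ub A v : l2norm v <= 1 -> l2norm (A *m v) <= opnorm A.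
Proof.
move=> v1; apply: ub_le_sup; last by exists v.
(* [ub_le_sup] requires a bounded set: [k] is the squared Frobenius norm, and [k + 1] exceeds its
   root. *)
pose k := normc (A 0 0) ^+ 2 + normc (A 1 0) ^+ 2
  + (normc (A 0 1) ^+ 2 + normc (A 1 1) ^+ 2).
have k0 : 0 <= k by rewrite !addr_ge0 ?sqr_ge0.
exists (k + 1) => _ [u /= u1 <-].
have hu : l2norm (A *m u) ^+ 2 <= k * l2norm u ^+ 2.
  apply: sqr_l2norm_mul_le; rewrite /k ?lerDl ?lerDr ?addr_ge0 ?sqr_ge0 //.
  by have := sqr_ge0 (normc (\det A)); lra.
have u0 := l2norm_ge0 u; have n0 := l2norm_ge0 (A *m u).
have : k * l2norm u ^+ 2 <= k * 1 by rewrite ler_wpM2l //; nra.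
nra.
Qed.

Lemma opnorm_lt1_tetrablock A : opnorm A < 1 ->
  tetrablock (A 0 0, A 1 1, \det A).
Proof.
move=> A1 z w z1 w1; apply/negP => /eqP E.
pose D : 'M[R[i]]_2 := diag_mx (\row_j if j == 0 then z else w).
have DE v : (D *m v) 0 0 = z * v 0 0 /\ (D *m v) 1 0 = w * v 1 0.
  by rewrite !mul_diag_mx !mxE.
(* Transposed because [det0P] yields a row vector. *)
have : \det (1%:M - A *m D)^T == 0.
  rewrite det_tr det_mx2E mul_mx_diag !mxE /= -E det_mx2E; apply/eqP; ring.
case/det0P => u u0 uM.
pose v := u^T.
have v0 : v != 0 by rewrite -(inj_eq (@trmx_inj _ _ _)) trmxK trmx0.
have Ev : A *m (D *m v) = v.
  apply/eqP; rewrite mulmxA eq_sym -subr_eq0 -{1}(mul1mx v) -mulmxBl.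
  by rewrite -(inj_eq (@trmx_inj _ _ _)) trmx_mul trmxK uM trmx0.
have lv : 0 < l2norm v by rewrite lt_neqAle l2norm_ge0 andbT eq_sym l2norm_eq0.
have lD : l2norm (D *m v) <= l2norm v.
  rewrite -ler_sqr ?nnegrE ?l2norm_ge0 // !sqr_l2norm2.
  have [-> ->] := DE v; rewrite !normcM !exprMn.
  by rewrite lerD // ler_piMl ?sqr_ge0 // expr_le1 ?normc_ge0.
(* [D v / |v|] lies in the unit ball, yet [A] maps it to the unit vector [v / |v|]. *)
have := @opnorm_ub A (((l2norm v)^-1)%:C%C *: (D *m v)).
have i0 : 0 <= (l2norm v)^-1 by rewrite invr_ge0 ltW.
rewrite -scalemxAr Ev !l2normZ // mulVf ?gt_eqF // [1 <= _]leNgt A1 /=.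
by rewrite mulrC ler_pdivrMr // mul1r lD => /(_ isT).
Qed.

Lemma opnorm_lt1 A :
  let F := normc (A 0 0) ^+ 2 + normc (A 0 1) ^+ 2
    + normc (A 1 0) ^+ 2 + normc (A 1 1) ^+ 2 in
  normc (\det A) < 1 -> F < 1 + normc (\det A) ^+ 2 -> opnorm A < 1.
Proof.
move=> F d1 h.
pose a := normc (A 0 0) ^+ 2 + normc (A 1 0) ^+ 2.
pose b := normc (A 0 1) ^+ 2 + normc (A 1 1) ^+ 2.
have a0 : 0 <= a by rewrite addr_ge0 ?sqr_ge0.
have b0 : 0 <= b by rewrite addr_ge0 ?sqr_ge0.
have d0 := normc_ge0 (\det A).
have FE : F = a + b by rewrite /F /a /b; ring.
rewrite FE in h; set d := normc (\det A) in d1 d0 h.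
have ab : 0 <= a * b - d ^+ 2 by rewrite -sqr_normc_gram sqr_ge0.
have d21 : d ^+ 2 < 1 by nra.
(* [1 + d^2 - F] is [(1 - a) (1 - b) - (a b - d^2)], the determinant of [1 - A^* A]. *)
have prod : 0 < (1 - a) * (1 - b) by lra.
have [a1 b1] : a < 1 /\ b < 1.
  by split; rewrite ltNge; apply/negP => ?; nra.
(* With [q = 1 + d^2 - a - b], this choice makes [(k - a) (k - b) - (a b - d^2)] equal to
   [q^2 / 4 + q (a + b) / 2]. *)
pose k := 1 - (1 + d ^+ 2 - (a + b)) / 2.
have k0 : 0 <= k by rewrite /k; nra.
have ka : a <= k by rewrite /k; nra.
have kb : b <= k by rewrite /k; nra.
have kab : a * b - d ^+ 2 <= (k - a) * (k - b) by rewrite /k; nra.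
apply: (@le_lt_trans _ _ (Num.sqrt k)); last first.
  by rewrite -[ltRHS]sqrtr1 ltr_sqrt // /k; lra.
apply: ge_sup.
  have l0 : l2norm (0 : 'cV[R[i]]_2) = 0 by apply/eqP; rewrite l2norm_eq0.
  by exists (l2norm (A *m 0)), 0; rewrite //= l0.
move=> _ [v /= v1 <-]; rewrite -ler_sqr ?nnegrE ?sqrtr_ge0 ?l2norm_ge0 //.
rewrite [Num.sqrt k ^+ 2]sqr_sqrtr //; apply: le_trans (sqr_l2norm_mul_le v ka kb kab) _.
by rewrite ler_piMr // expr_le1 // l2norm_ge0.
Qed.

End OperatorNorm.

(** * The symmetric matrix of (8) and the parameters of (9) *)

Section Characterizations.
Variable R : realType.
Implicit Types x : R[i].

Lemma symmetric_matrix_gaps x1 x2 x3 : tetra_gaps x1 x2 x3 ->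
  exists A : 'M[R[i]]_2,
    [/\ A^T = A, opnorm A < 1 & (x1, x2, x3) = (A 0 0, A 1 1, \det A)].
Proof.
move/(gapsP (coupled_normc x1 x2 x3)) => [P t1].
pose b := sqrtc (x1 * x2 - x3).
have bb : b * b = x1 * x2 - x3 by rewrite -expr2 sqr_sqrtc.
pose A : 'M[R[i]]_2 :=
  \matrix_(i, j) if i != j then b else if i == 0 then x1 else x2.
have dA : \det A = x3 by rewrite det_mx2E !mxE /= bb; ring.
exists A; split; last by rewrite dA !mxE.
  by apply/matrixP => i j; rewrite !mxE eq_sym; case: eqP => // ->.
have nb : normc b ^+ 2 = normc (x1 * x2 - x3) by rewrite -bb normcM expr2.
by apply: opnorm_lt1; rewrite dA // !mxE /= nb; lra.
Qed.

Lemma beta_gaps x1 x2 x3 :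
  (normc x3 < 1 /\ exists b1 b2 : R[i],
    [/\ normc b1 + normc b2 < 1, x1 = b1 + b2^*%C * x3 & x2 = b2 + b1^*%C * x3])
  <-> normc x3 < 1 /\
    normc (x1 - x2^*%C * x3) + normc (x2 - x1^*%C * x3) < 1 - normc x3 ^+ 2.
Proof.
pose D := 1 - normc x3 ^+ 2.
have D0 : normc x3 < 1 -> 0 < D by move=> t1; have := normc_ge0 x3; rewrite /D; nra.
have DC : D%:C%C = 1 - x3^*%C * x3.
  rewrite /D sqr_normcE; case: x3 {D D0} => a b.
  by apply/eqP; rewrite eq_complex /=; apply/andP; split; apply/eqP; ring.
have solve b1 b2 : b1 + b2^*%C * x3 - (b2 + b1^*%C * x3)^*%C * x3 = D%:C%C * b1.
  by rewrite DC rmorphD rmorphM /= conjcK; ring.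
split=> -[t1]; have {}D0 := D0 t1.
  move=> [b1 [b2 [h -> ->]]]; split=> //.
  rewrite !solve !normcM !normc_real ?ltW // -mulrDr -/D.
  by rewrite gtr_pMr.
move=> h; split=> //.
have Dn : D%:C%C != 0 by rewrite -normc_eq0 normc_real ?gt_eqF // ltW.
have conj u v : ((u - v^*%C * x3) / D%:C%C)^*%C = (u^*%C - v * x3^*%C) / D%:C%C.
  transitivity ((u - v^*%C * x3)^*%C * (D%:C%C^-1)^*%C); first exact: rmorphM.
  by rewrite conjc_inv conjc_real rmorphB rmorphM /= conjcK.
exists ((x1 - x2^*%C * x3) / D%:C%C), ((x2 - x1^*%C * x3) / D%:C%C); split.
- rewrite !normcM normcV normc_real ?ltW // -mulrDl ltr_pdivrMr // mul1r; exact: h.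
- by rewrite conj; apply: (mulIf Dn); rewrite mulrDl divfK // mulrAC divfK // DC; ring.
- by rewrite conj; apply: (mulIf Dn); rewrite mulrDl divfK // mulrAC divfK // DC; ring.
Qed.

End Characterizations.

Theorem theorem2p2 (R : realType) (x1 x2 x3 : R[i]) :
  let x := (x1, x2, x3) in
  [<->
    (* (1) *)
    tetrablock x;
    (* (2) *)
    (Hinf_norm (fun z => Psi z x) < 1)%E /\ (x1 * x2 = x3 -> normc x2 < 1);
    (* (2') *)
    (Hinf_norm (fun z => Upsilon z x) < 1)%E /\ (x1 * x2 = x3 -> normc x1 < 1);
    (* (3) *)
    normc (x1 - x2^*%C * x3) + normc (x1 * x2 - x3) < 1 - normc x2 ^+ 2;
    (* (3') *)
    normc (x2 - x1^*%C * x3) + normc (x1 * x2 - x3) < 1 - normc x1 ^+ 2;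
    (* (4) *)
    normc x1 ^+ 2 - normc x2 ^+ 2 + normc x3 ^+ 2
      + 2 * normc (x2 - x1^*%C * x3) < 1 /\ normc x2 < 1;
    (* (4') *)
    - normc x1 ^+ 2 + normc x2 ^+ 2 + normc x3 ^+ 2
      + 2 * normc (x1 - x2^*%C * x3) < 1 /\ normc x1 < 1;
    (* (5) *)
    normc x1 ^+ 2 + normc x2 ^+ 2 - normc x3 ^+ 2
      + 2 * normc (x1 * x2 - x3) < 1 /\ normc x3 < 1;
    (* (6) *)
    normc (x1 - x2^*%C * x3) + normc (x2 - x1^*%C * x3) < 1 - normc x3 ^+ 2;
    (* (7) *)
    exists A : 'M[R[i]]_2, opnorm A < 1 /\ x = (A 0 0, A 1 1, \det A);
    (* (8) *)
    exists A : 'M[R[i]]_2,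
      [/\ A^T = A, opnorm A < 1 & x = (A 0 0, A 1 1, \det A)];
    (* (9) *)
    normc x3 < 1 /\
    exists b1 b2 : R[i],
      [/\ normc b1 + normc b2 < 1,
          x1 = b1 + b2^*%C * x3 & x2 = b2 + b1^*%C * x3]
  ].
Proof.
move=> x.
have C := coupled_normc x1 x2 x3.
have C21 := coupled_rs C.
have H1 := tetrablock_gaps x1 x2 x3.
have H2 := Psi_gaps x1 x2 x3.
(* Primed conditions are the unprimed ones with [x1] and [x2] exchanged. *)
have H2' := Psi_gaps x2 x1 x3; rewrite [x2 * x1]mulrC tetra_gapsC in H2'.
have H3 := gaps_sumP C.
have H3' := gaps_sumP C21.
have H4 := tetra_gapsP4 x1 x2 x3.
have H4' := tetra_gapsP4 x2 x1 x3; rewrite tetra_gapsC in H4'.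
have H5 := gapsP C.
have H6 := gaps_sumP (coupled_st C).
(* The converse is provided by the symmetric matrix of [H8]. *)
have H7 (A : 'M[R[i]]_2) : opnorm A < 1 /\ x = (A 0 0, A 1 1, \det A) -> tetra_gaps x1 x2 x3.
  by move=> [A1 [-> -> ->]]; apply/tetrablock_gaps; apply: opnorm_lt1_tetrablock.
have H8 := @symmetric_matrix_gaps R x1 x2 x3.
have H9 := beta_gaps x1 x2 x3.
have sw : gaps (normc x2) (normc x1) (normc x3) (normc (x2 - x1^*%C * x3))
    (normc (x1 - x2^*%C * x3)) (normc (x1 * x2 - x3)) <-> tetra_gaps x1 x2 x3.
  by split=> /gaps_rs.
have st : gaps (normc x1) (normc x3) (normc x2) (normc (x1 - x2^*%C * x3))
    (normc (x1 * x2 - x3)) (normc (x2 - x1^*%C * x3)) <-> tetra_gaps x1 x2 x3.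
  by split=> /gaps_st.
rewrite sw in H3'; rewrite st in H6.
tfae.
- by move/H1/H2.
- by move/H2/H2'.
- by move/H2'/H3.
- by move/H3/H3'.
- by move/H3'/H4 => -[S s1]; split=> //; lra.
- move=> [S s1]; have G : tetra_gaps x1 x2 x3 by apply/H4; split=> //; lra.
  by have [Q r1] := H4'.1 G; split=> //; lra.
- move=> [Q r1]; have G : tetra_gaps x1 x2 x3 by apply/H4'; split=> //; lra.
  by have [P t1] := H5.1 G; split=> //; lra.
- move=> [P t1]; apply/H6/H5; split=> //; lra.
- move=> /H6/H8[A [_ A1 xA]]; by exists A.
- by move=> [A /H7/H8].
- move=> [A [_ A1 xA]]; have G : tetra_gaps x1 x2 x3 by apply: (H7 A).
  by apply/H9; have [_ t1] := H5.1 G; split=> //; apply/H6.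
- by move=> /H9[_ /H6/H1].
Qed.
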